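(* There are absolute constants $c>0$ and $C\ge 0$ such that for every finite convex set $A\subset\mathbb{R}$ with $|A|\ge 2$, \[ |A-A|\ge c\,\frac{|A|^{8/5}}{(\log|A|)^{C}}. \]
   Context: A finite set $A=\{a_1<a_2<\dots<a_k\}\subset\mathbb{R}$ is convex if $a_i-a_{i-1}<a_{i+1}-a_i$ for all $1<i<k$. $A-A=\{a-b:a,b\in A\}$. *)

(* Defs.v *)
From Stdlib Require Import Reals List.
Import ListNotations.
Open Scope R_scope.

(* A finite set A = {a_0 < a_1 < ... < a_{k-1}} of reals is represented by
   the list of its elements in strictly increasing order. *)
Definition strictly_increasing (A : list R) : Prop :=
  forall i : nat, (S i < length A)%nat -> nth i A 0 < nth (S i) A 0.

Definition convex_list (A : list R) : Prop :=
  forall i : nat, (S (S i) < length A)%nat ->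
    nth (S i) A 0 - nth i A 0 < nth (S (S i)) A 0 - nth (S i) A 0.

Definition diffs (A : list R) : list R :=
  flat_map (fun a => map (fun b => a - b) A) A.

Definition diffset_card (A : list R) : nat :=
  length (nodup Req_EM_T (diffs A)).

(* Main.v *)
(* For a convex set A of size n and any B, at most O(n |B|^2 / t^3) numbers s
   have t representations s = a - b. Indeed such an s yields about t pairs of
   representations (a, b), (a', b') with a' - a = b' - b whose index gaps are
   O(n / t) in A and O(|B| / t) in B; by convexity the index gap in A together
   with the value b' - b determines a, hence the pair determines s.
   Summing over t, the third moment of the number r(s) of representations is
   O(n |B|^2 log n).

   Let D = A - A and A_s = A /\ (A + s), so |A_s| = r(s). Cauchy-Schwarz gives
   (n |A_s|)^2 <= |A_s - A| E(A_s, A), with E the additive energy. Here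
   A_s - A is contained in D /\ (D + s) (Katz-Koester), and the E(A_s, A) sum
   over s to at most the third moment of r. Hoelder's inequality then bounds
   n^8 by |D| times the third moment of r times E(A, D), and
   E(A, D)^2 <= n |D| * O(n |D|^2 log n). Together, n^8 = O(|D|^5 (log n)^3). *)
Require Import Defs.
From Stdlib Require Import Reals List Lra.
From mathcomp Require all_boot all_order all_algebra zify ring lra Rstruct.
Open Scope R_scope.

(** * Logarithms and real powers *)

(** Apply [1 + y <= exp y] at [y = ln (x / (x + 1))]. This is the induction step that bounds
    harmonic sums by a logarithm. *)
Lemma inv_le_ln_succ_sub (n : nat) : / INR (S (S n)) <=
  ln (INR (S (S n))) - ln (INR (S n)).
Proof.
  pose proof (lt_0_INR (S n) (Nat.lt_0_succ n)) as H.
  rewrite (S_INR (S n)); set (x := INR (S n)) in *.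
  assert (0 < x / (x + 1)) as P by (apply Rdiv_lt_0_compat; lra).
  pose proof (exp_ineq1_le (ln (x / (x + 1)))) as E; rewrite exp_ln in E by lra.
  replace (ln x) with (ln ((x + 1) * (x / (x + 1)))) by (f_equal; field; lra).
  rewrite ln_mult by lra.
  replace (x / (x + 1)) with (1 - / (x + 1)) in * by (field; lra).
  lra.
Qed.

Lemma Rpower_pow_l (x y : R) (n : nat) : Rpower x y ^ n = Rpower x (y * INR n).
Proof. rewrite <- Rpower_pow by apply exp_pos. apply Rpower_mult. Qed.

(* The module confines MathComp's notations, so that the theorem below is read
   with those of Stdlib. *)
Module ConvexDifference.
Import all_boot all_order all_algebra zify ring lra Rstruct.
Import Order.TTheory GRing.Theory Num.Theory.
Set Implicit Arguments. Unset Strict Implicit. Unset Printing Implicit Defensive.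
Local Open Scope ring_scope.

(** * Representation counts *)

Definition rep (V : zmodType) (X Y : seq V) (s : V) : nat :=
  (\sum_(x <- X) \sum_(y <- Y) (x - y == s)%R)%N.

Lemma sum_delta (T : eqType) (S : seq T) (u : T) (f : T -> nat) :
  uniq S -> u \in S -> (\sum_(s <- S) (u == s) * f s)%N = f u.
Proof.
move=> uS uin; rewrite (bigD1_seq u) //= eqxx mul1n big1 ?addn0 // => s.
by rewrite eq_sym => /negbTE ->.
Qed.

(** Exchange the sums: as [S] has no repetition, each pair meets exactly one [s], its own
    difference. *)
Lemma sum_rep (V : zmodType) (S X Y : seq V) (f : V -> nat) :
  uniq S -> {in X & Y, forall x y, x - y \in S} ->
  (\sum_(s <- S) rep X Y s * f s =
   \sum_(x <- X) \sum_(y <- Y) f (x - y)%R)%N.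
Proof.
move=> uS XY; under eq_bigr => s _ do rewrite big_distrl /=.
rewrite exchange_big; apply: eq_big_seq => x xX /=.
under eq_bigr => s _ do rewrite big_distrl /=.
rewrite exchange_big; apply: eq_big_seq => y yY /=.
exact/sum_delta/XY.
Qed.

Lemma rep_count (V : zmodType) (X Y : seq V) (s : V) :
  uniq Y -> rep X Y s = count (fun x => x - s \in Y) X.
Proof.
move=> uY; rewrite -sum1_count [RHS]big_mkcond; apply: eq_bigr => x _ /=.
case: ifP => [yY|/negP nY].
  rewrite -[RHS](sum_delta (fun=> 1%N) uY yY); apply: eq_bigr => y _.
  by rewrite muln1 subr_eq addrC -subr_eq.
rewrite big_seq big1 // => y yY; case: eqP => // xy.
by case: nY; rewrite -xy opprB addrC subrK.
Qed.

(** * Inequalities for finite sums *)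

(** Lagrange's identity: once doubled and symmetrised in [(s, t)], the two sides differ by the sum
    of the squares of [f s * g t - f t * g s]. *)
Lemma sqr_sum_le (F : realDomainType) (T : Type) (S : seq T) (f g : T -> F) :
  (\sum_(s <- S) f s * g s) ^+ 2 <=
  (\sum_(s <- S) f s ^+ 2) * (\sum_(s <- S) g s ^+ 2).
Proof.
rewrite -(ler_pMn2r (isT : (0 < 2)%N)) expr2 !big_distrlr /=.
rewrite mulr2n [leRHS]mulr2n [X in _ <= X + _]exchange_big -!big_split /=.
apply: ler_sum => s _; rewrite -!big_split /=; apply: ler_sum => t _.
have := sqr_ge0 (f s * g t - f t * g s); nra.
Qed.

Lemma sqr_sum_nat_le (T : Type) (S : seq T) (f g : T -> nat) :
  ((\sum_(s <- S) f s * g s) ^ 2 <=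
   (\sum_(s <- S) f s ^ 2) * (\sum_(s <- S) g s ^ 2))%N.
Proof.
rewrite -(ler_nat int) natrM natrX !natr_sum.
under eq_bigr do rewrite natrM.
under [X in X * _]eq_bigr do rewrite natrX.
under [X in _ * X]eq_bigr do rewrite natrX.
exact: sqr_sum_le.
Qed.

(* Hölder's inequality for three functions, one of them constant. *)
Lemma holder3_le (F : rcfType) (T : eqType) (S : seq T) (c : F)
    (x e g : T -> F) :
  0 <= c ->
  {in S, forall s, [/\ 0 <= x s, 0 <= e s, 0 <= g s
                     & c * x s ^+ 3 <= e s * g s]} ->
  c * (\sum_(s <- S) x s) ^+ 3 <=
  (size S)%:R * (\sum_(s <- S) e s) * (\sum_(s <- S) g s).
Proof.
(* [Y k] is the sum of [x ^ (k / 2)]. Cauchy-Schwarz, used three times, bounds [Y 1 ^ 2], [Y 2 ^ 2]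
   and [c * Y 3 ^ 2]; eliminating [Y 1] leaves [Y 2 ^ 3 <= |S| * Y 3 ^ 2]. *)
move=> c0 H; pose y s := Num.sqrt (x s); pose Y k := \sum_(s <- S) y s ^+ k.
have y0 s : 0 <= y s by rewrite sqrtr_ge0.
have Y0 k : 0 <= Y k by apply: sumr_ge0 => s _; rewrite exprn_ge0.
have xE : \sum_(s <- S) x s = Y 2%N.
  by apply: eq_big_seq => s /H[x0 _ _ _]; rewrite sqr_sqrtr.
have E0 : 0 <= \sum_(s <- S) e s by rewrite big_seq sumr_ge0 // => s /H[].
have G0 : 0 <= \sum_(s <- S) g s by rewrite big_seq sumr_ge0 // => s /H[].
have Y12 : Y 1%N ^+ 2 <= (size S)%:R * Y 2%N.
  have := sqr_sum_le S (fun=> 1) y.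
  rewrite -!/(Y _); under eq_bigr do rewrite mul1r -[y _]expr1.
  by under [X in X * _]eq_bigr do rewrite expr1n;
    rewrite big_const_seq count_predT iter_addr_0.
have Y123 : Y 2%N ^+ 2 <= Y 1%N * Y 3%N.
  pose z s := Num.sqrt (y s); have z2 s : z s ^+ 2 = y s by rewrite sqr_sqrtr.
  have := sqr_sum_le S z (fun s => z s * y s).
  under eq_bigr do rewrite mulrA -[z _ * z _]expr2 z2.
  under [X in X * _]eq_bigr do rewrite z2.
  by under [X in _ * X]eq_bigr do rewrite exprMn z2 -exprS.
have Y3 : c * Y 3%N ^+ 2 <= (\sum_(s <- S) e s) * (\sum_(s <- S) g s).
  have le s : s \in S -> Num.sqrt c * y s ^+ 3 <= Num.sqrt (e s) * Num.sqrt (g s).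
    move=> /H[x0 e0 g0 le]; rewrite -sqrtrM // -(ler_pXn2r (isT : (0 < 2)%N)) ?nnegrE.
    - by rewrite sqr_sqrtr ?mulr_ge0 // exprMn sqr_sqrtr //
      -exprM mulnC exprM sqr_sqrtr.
    - by rewrite mulr_ge0 ?sqrtr_ge0 // exprn_ge0.
    - by rewrite sqrtr_ge0.
  have := sqr_sum_le S (fun s => Num.sqrt (e s)) (fun s => Num.sqrt (g s)).
  have -> : \sum_(s <- S) Num.sqrt (e s) ^+ 2 = \sum_(s <- S) e s.
    by apply: eq_big_seq => s /H[_ e0 _ _]; rewrite sqr_sqrtr.
  have -> : \sum_(s <- S) Num.sqrt (g s) ^+ 2 = \sum_(s <- S) g s.
    by apply: eq_big_seq => s /H[_ _ g0 _]; rewrite sqr_sqrtr.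
  apply: le_trans; rewrite -[c]sqr_sqrtr // -exprMn mulr_sumr.
  rewrite ler_pXn2r ?nnegrE ?sumr_ge0 // => [|s _|s _].
  - by rewrite big_seq [leRHS]big_seq; apply: ler_sum.
  - by rewrite mulr_ge0 ?sqrtr_ge0 // exprn_ge0.
  - by rewrite mulr_ge0 ?sqrtr_ge0.
rewrite xE; set E := \sum_(s <- S) e s in E0 Y3 *.
set G := \sum_(s <- S) g s in G0 Y3 *.
have [->|Yn0] := eqVneq (Y 2%N) 0.
  by rewrite expr0n /= mulr0 !mulr_ge0.
have Yp : 0 < Y 2%N by rewrite lt_neqAle eq_sym Yn0 Y0.
have {}Y123 : Y 2%N ^+ 3 <= (size S)%:R * Y 3%N ^+ 2.
  have h : (Y 2%N ^+ 2) ^+ 2 <= (Y 1%N * Y 3%N) ^+ 2.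
    by rewrite ler_pXn2r ?nnegrE ?mulr_ge0 ?exprn_ge0.
  have h2 : (Y 1%N * Y 3%N) ^+ 2 <= (size S)%:R * Y 2%N * Y 3%N ^+ 2.
    by rewrite exprMn ler_wpM2r ?exprn_ge0.
  rewrite -(ler_pM2r Yp); lra.
apply: le_trans (ler_wpM2l c0 Y123) _; rewrite mulrCA -mulrA.
exact: ler_wpM2l.
Qed.

(** Layer-cake summation: [k ^ 3] is at most the sum of [3 t ^ 2] over [1 <= t <= k], and each level
    set has at most [K / t ^ 3] points, so level [t] contributes at most [3 K / t]. *)
Lemma sum_cube_level_le (F : realFieldType) (T : Type) (S : seq T) (f : T -> nat)
    (K n : nat) :
  (forall t, (t ^ 3 * count (fun s => t <= f s) S <= K)%N) ->
  (forall s, (f s <= n)%N) ->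
  (\sum_(s <- S) f s ^ 3)%:R <=
  (3 * K)%:R * \sum_(1 <= t < n.+1) t%:R^-1 :> F.
Proof.
move=> HK Hn.
have cube k : (k ^ 3 <= \sum_(1 <= t < k.+1) 3 * t ^ 2)%N.
  elim: k => [|k IH]; first by rewrite big_geq.
  rewrite big_nat_recr //=; lia.
have le1 : (\sum_(s <- S) f s ^ 3 <=
    \sum_(1 <= t < n.+1) 3 * t ^ 2 * count (fun s => t <= f s) S)%N.
  under [leqRHS]eq_bigr => t _ do rewrite -sum1_count big_mkcond big_distrr /=.
  rewrite exchange_big /=; apply: leq_sum => s _.
  apply: (leq_trans (cube (f s))).
  rewrite [leqRHS](@big_cat_nat _ _ _ (f s).+1) ?ltnS //=.
  apply: leq_trans (leq_addr _ _); rewrite big_nat [leqRHS]big_nat.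
  by apply: leq_sum => t /andP[_]; rewrite ltnS => ->; rewrite muln1.
apply: le_trans (_ : _ <= (\sum_(1 <= t < n.+1) 3 * t ^ 2 * count (fun s => t <=
  f s) S)%:R) _.
  by rewrite ler_nat.
rewrite natr_sum mulr_sumr big_nat [leRHS]big_nat.
apply: ler_sum => t /andP[t0 _].
rewrite ler_pdivlMr ?ltr0n // -natrM ler_nat.
have := HK t; rewrite -mulnA -mulnA leq_mul2l /= => /(leq_trans _); apply.
by apply/eq_leq; lia.
Qed.

(** * Convex sequences and ranks *)

Lemma lt_succ_homo (F : realDomainType) (n : nat) (f : nat -> F) :
  (forall i, (i.+1 < n)%N -> f i < f i.+1) ->
  forall i j, (i < j < n)%N -> f i < f j.
Proof.
move=> H i; elim=> [|j IH] /andP[ij jn] //.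
move: ij; rewrite ltnS leq_eqVlt => /orP[/eqP->|ij]; first exact: H.
by apply: lt_trans (IH _) (H _ jn); rewrite ij ltnW.
Qed.

Definition convex_seq (F : realDomainType) (A : seq F) : Prop :=
  (forall i, (i.+1 < size A)%N -> A`_i < A`_i.+1) /\
  (forall i, (i.+2 < size A)%N -> A`_i.+1 - A`_i < A`_i.+2 - A`_i.+1).

Lemma convex_seq_lt (F : realDomainType) (A : seq F) (i j : nat) :
  convex_seq A -> (i < j < size A)%N -> A`_i < A`_j.
Proof. by case=> H _; apply: lt_succ_homo. Qed.

Lemma convex_seq_uniq (F : realDomainType) (A : seq F) :
  convex_seq A -> uniq A.
Proof.
move=> cA; apply/(uniqP 0) => i j; rewrite !inE => iA jA eq.
case: (ltngtP i j) => // ij.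
- by have := convex_seq_lt (i := i) (j := j) cA; rewrite ij jA eq ltxx => /(_ isT).
- by have := convex_seq_lt (i := j) (j := i) cA; rewrite ij iA eq ltxx => /(_ isT).
Qed.

(** Passing from [k] to [k + 1] changes the gap by the consecutive difference at [k + d] minus the
    one at [k], which is positive by convexity. *)
Lemma convex_seq_gap_lt (F : realDomainType) (A : seq F) (d i j : nat) :
  convex_seq A -> (0 < d)%N -> (i < j)%N -> (j + d < size A)%N ->
  A`_(i + d) - A`_i < A`_(j + d) - A`_j.
Proof.
move=> [_ H] d0 ij jd.
apply: (@lt_succ_homo _ (size A - d) (fun i => A`_(i + d) - A`_i)); last first.
  by rewrite ij; lia.
move=> k kd.
have := @lt_succ_homo _ (size A).-1 (fun i => A`_i.+1 - A`_i) _ k (k + d).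
have -> : (k < k + d < (size A).-1)%N by lia.
move=> h; have {h} := h _ isT; rewrite addSn => h.
suff: A`_k.+1 - A`_k < A`_(k + d).+1 - A`_(k + d) by lra.
by apply: h => l hl; apply: H; lia.
Qed.

Lemma convex_seq_gap_inj (F : realDomainType) (A : seq F) (d i j : nat) :
  convex_seq A -> (0 < d)%N -> (i + d < size A)%N -> (j + d < size A)%N ->
  A`_(i + d) - A`_i = A`_(j + d) - A`_j -> i = j.
Proof.
move=> cA d0 id jd eq; case: (ltngtP i j) => // ij.
- by have := convex_seq_gap_lt cA d0 ij jd; rewrite eq ltxx.
- by have := convex_seq_gap_lt cA d0 ij id; rewrite eq ltxx.
Qed.

(** [B] need not be sorted; the rank replaces the index in increasing order. *)
Definition rank (F : realDomainType) (B : seq F) (b : F) : nat :=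
  count (fun x => x < b) B.

Lemma rank_lt (F : realDomainType) (B : seq F) (b c : F) :
  b \in B -> b < c -> (rank B b < rank B c)%N.
Proof.
move=> bB bc; rewrite /rank !(permP (perm_to_rem bB)) /= ltxx bc add0n ltnS.
by apply: sub_count => x /= /lt_trans; apply.
Qed.

Lemma rank_inj (F : realDomainType) (B : seq F) :
  {in B &, injective (rank B)}.
Proof.
move=> b c bB cB eq; case: (ltgtP b c) => // lt.
- by have := rank_lt bB lt; rewrite eq ltnn.
- by have := rank_lt cB lt; rewrite eq ltnn.
Qed.

Lemma rank_size (F : realDomainType) (B : seq F) (b : F) :
  b \in B -> (rank B b < size B)%N.
Proof.
move=> bB; rewrite /rank (perm_size (perm_to_rem bB)).
rewrite (permP (perm_to_rem bB)) /= ltxx add0n ltnS.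
exact: count_size.
Qed.

Lemma card_inj_le (T : finType) (U : eqType) (D : {set T}) (f : T -> U)
    (L : seq U) :
  {in D &, injective f} -> {in D, forall x, f x \in L} -> (#|D| <= size L)%N.
Proof.
move=> inj fL; rewrite cardE -(size_map f); apply: uniq_leq_size.
  rewrite map_inj_in_uniq ?enum_uniq // => x y.
  by rewrite !mem_enum; apply: inj.
by move=> u /mapP[x]; rewrite mem_enum => xD ->; apply: fL.
Qed.

(** * Close pairs and differences with many representations *)

Definition hit (F : realDomainType) (A B : seq F) (s : F) (i : nat) : bool :=
  A`_i - s \in B.

(** Division by [l] and [m] cuts the plane of (index, rank) into cells; two points of one cell have
    index gap below [l] and rank gap below [m]. *)
Definition close (F : realDomainType) (A B : seq F) (l m : nat) (s : F)
    (i j : nat) : bool :=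
  [&& hit A B s i, hit A B s j, i < j, i %/ l == j %/ l
    & rank B (A`_i - s)%R %/ m == rank B (A`_j - s)%R %/ m]%N.

Lemma divn_eq_sub_lt (k i j : nat) :
  (0 < k)%N -> (i %/ k = j %/ k)%N -> (j - i < k)%N.
Proof.
move=> k0 eq; rewrite {1}(divn_eq j k) {1}(divn_eq i k) eq subnDl.
by rewrite (leq_ltn_trans (leq_subr _ _)) ?ltn_mod.
Qed.

(* A close pair is recovered from its index gap in [A], the rank of its lower
   element of [B] and the rank gap in [B], because by convexity the gap and the
   difference [A`_j - A`_i] determine [i]. *)
Lemma card_close_le (F : realDomainType) (A B S : seq F) (l m : nat) :
  convex_seq A -> uniq S -> (0 < l)%N -> (0 < m)%N ->
  (#|[set x : 'I_(size S) * 'I_(size A) |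
       [exists j : 'I_(size A), close A B l m S`_x.1 x.2 j]]| <= l * size B * m)%N.
Proof.
move=> cA uS l0 m0; set G := finset _.
pose nx (x : 'I_(size S) * 'I_(size A)) : 'I_(size A) :=
  odflt x.2 [pick j : 'I_(size A) | close A B l m S`_x.1 x.2 j].
have nxP x : x \in G -> close A B l m S`_x.1 x.2 (nx x).
  rewrite inE => /existsP[j Hj]; rewrite /nx; case: pickP => //= /(_ j).
  by rewrite Hj.
pose rk (x : 'I_(size S) * 'I_(size A)) (i : nat) := rank B (A`_i - S`_x.1)%R.
pose f x := ((nx x - x.2, rk x x.2), rk x (nx x) - rk x x.2)%N.
pose L := [seq (p, e) | p <- [seq (d, j) | d <- iota 0 l, j <- iota 0 (size B)],
  e <- iota 0 m].
have -> : (l * size B * m = size L)%N by rewrite !size_allpairs !size_iota.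
have lt x : x \in G -> (rk x x.2 < rk x (nx x))%N.
  move=> /nxP/and5P[hi _ ij _ _]; apply: rank_lt => //.
  by rewrite ltrD2r; apply: convex_seq_lt; rewrite // ij /=.
apply: (@card_inj_le _ _ _ f) => [x y xG yG [ed ej ee]|x xG].
- have := lt _ xG; have := lt _ yG.
  have /and5P[hx hx' ix _ _] := nxP _ xG; have /and5P[hy hy' iy _ _] := nxP _ yG.
  move=> ry rx.
  have e1 : A`_x.2 - S`_x.1 = A`_y.2 - S`_y.1 by apply: (@rank_inj _ B).
  have e2 : A`_(nx x) - S`_x.1 = A`_(nx y) - S`_y.1.
    have er : rk x (nx x) = rk y (nx y).
      by rewrite -(subnKC (ltnW rx)) -(subnKC (ltnW ry)) ee ej.
    exact: (@rank_inj _ B).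
  (* Subtracting [e1] from [e2] cancels the shifts: the two pairs have the same index gap and the
     same difference in [A]. *)
  have e3 : x.2 = y.2.
    apply/val_inj/(@convex_seq_gap_inj _ A (nx x - x.2)) => //=; rewrite ?subn_gt0 //.
    + by rewrite subnKC // ltnW.
    + by rewrite ed subnKC // ltnW.
    + rewrite {2}ed !subnKC; try exact: ltnW.
      by move: e1 e2; lra.
  have e4 : x.1 = y.1.
    apply/val_inj/eqP; rewrite -(nth_uniq 0 (ltn_ord x.1) (ltn_ord y.1) uS).
    by move: e1; rewrite e3 => /addrI/oppr_inj ->.
  by case: x y e3 e4 {xG yG ed ej ee rx ry hx hx' hy hy' ix iy e1 e2} => [? ?] [?
    ?] /= -> ->.
- have /and5P[hx hx' ix /eqP el /eqP em] := nxP _ xG.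
  apply: allpairs_f; first apply: allpairs_f.
  + by rewrite mem_iota /= divn_eq_sub_lt.
  + by rewrite mem_iota /= rank_size.
  + by rewrite mem_iota /= divn_eq_sub_lt.
Qed.

(* The points (index in [A], rank in [B]) of the representations of [s] form a
   monotone chain, so they meet few cells of the grid with cells of size l x m,
   and only the last point in each cell starts no close pair. *)
Lemma card_close_ge (F : realDomainType) (A B : seq F) (l m : nat) (s : F)
    (t : nat) :
  convex_seq A -> uniq B -> (4 * size A < t * l)%N -> (4 * size B < t * m)%N ->
  (t <= rep A B s)%N ->
  (t./2 <= #|[set i : 'I_(size A) | [exists j : 'I_(size A), close A B l m s i j]]|)%N.
Proof.
move=> cA uB tl tm; rewrite rep_count // => ts; set G := finset _.
pose X := [set i : 'I_(size A) | hit A B s i].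
have tX : (t <= #|X|)%N.
  apply: (leq_trans ts); rewrite cardsE cardE size_filter -enumT /=.
  rewrite -{1}(mkseq_nth 0 A) /mkseq count_map -val_enum_ord count_map.
  exact: leqnn.
have GX : G \subset X by apply/subsetP => i; rewrite !inE => /existsP[j /and5P[]].
suff : (#|X :\: G| <= uphalf t)%N by rewrite cardsDS // ; move: tX; lia.
rewrite -(size_iota 0 (uphalf t)).
pose r (i : nat) := rank B (A`_i - s).
(* On a monotone chain the sum of the two cell coordinates already identifies the cell. Each
   coordinate is below [t / 4], so the sum is below [uphalf t]. *)
apply: (@card_inj_le _ _ _ (fun i : 'I_(size A) => i %/ l + r i %/ m)%N) => [i j|i].
- wlog ij : i j / (i < j)%N => [H|].
    case: (ltngtP i j) => [/H| /H h iX jX /esym /h ->|/val_inj] //.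
  rewrite !inE negb_exists => /andP[/forallP/(_ j) ni hi] /andP[_ hj] eq.
  have rij : (r i < r j)%N.
    apply: rank_lt => //; rewrite ltrD2r; apply: convex_seq_lt => //.
    by rewrite ij /=.
  have h1 : (i %/ l <= j %/ l)%N by apply/leq_div2r/ltnW.
  have h2 : (r i %/ m <= r j %/ m)%N by apply/leq_div2r/ltnW.
  by case/negP: ni; rewrite /close hi hj ij -/(r i) -/(r j) /=; apply/andP; split;
    apply/eqP; move: eq h1 h2; lia.
- rewrite !inE mem_iota => /andP[_ hi] /=.
  have quarter (k n b : nat) : (b < n)%N -> (4 * n < t * k)%N -> (4 * (b %/ k) < t)%N.
    move=> bn tk; have := leq_trunc_div b k; nia.
  have := quarter _ _ _ (ltn_ord i) tl; have := quarter _ _ _ (rank_size hi) tm.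
  by rewrite -/(r i); lia.
Qed.

(** Compare the upper and lower counts of close pairs. The constant is [3 * 5 * 5]: [t <= 3 * t./2]
    for [t >= 2], while [t <= |A|] and [t <= |B|] give [t * l <= 5 |A|] and [t * m <= 5 |B|]. *)
Lemma size_rich_le (F : realDomainType) (A B S : seq F) (t : nat) :
  convex_seq A -> uniq B -> uniq S ->
  {in S, forall s, (t <= rep A B s)%N} ->
  (t ^ 3 * size S <= 75 * (size A * size B ^ 2))%N.
Proof.
move=> cA uB uS H.
have [->|S0] := eqVneq S [::]; first by rewrite muln0.
case: t H => [|[|t']] H; first by [].
(* For [t = 1] the pair count is void, since [t./2 = 0]; here [S] merely lies in [A - B]. *)
- suff h : (size S <= size A * size B)%N by nia.
  rewrite -(size_allpairs (fun x y => x - y)); apply: uniq_leq_size => // s /H.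
  rewrite rep_count // -has_count => /hasP[a aA bB].
  apply/allpairsP; exists (a, a - s); split => //=.
  by rewrite opprB addrC subrK.
- set t := t'.+2 in H *.
  pose l := (4 * size A %/ t).+1; pose m := (4 * size B %/ t).+1.
  have tl : (4 * size A < t * l)%N by rewrite [(t * _)%N]mulnC ltn_ceil.
  have tm : (4 * size B < t * m)%N by rewrite [(t * _)%N]mulnC ltn_ceil.
  have up := card_close_le B (l := l) (m := m) cA uS isT isT.
  have lo : (size S * t./2 <= #|[set x : 'I_(size S) * 'I_(size A) |
       [exists j : 'I_(size A), close A B l m S`_x.1 x.2 j]]|)%N.
    set G := finset _.
    have -> : #|G| = (\sum_k \sum_i ((k, i) \in G))%N.
      rewrite pair_bigA -sum1_card big_mkcond; apply: eq_bigr => -[k i] _ /=.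
      by case: (_ \in G).
    rewrite -[X in (X * _)%N]card_ord -sum_nat_const; apply: leq_sum => k _.
    apply: leq_trans (card_close_ge cA uB tl tm (H _ (mem_nth 0 (ltn_ord k)))) _.
    by rewrite -sum1_card big_mkcond; apply: leq_sum => i _; rewrite !inE; case: ifP.
  have [s sS] : exists s, s \in S by case: S S0 {uS H up lo} => // s S _; exists s;
    rewrite mem_head.
  have tA : (t <= size A)%N.
    by apply: leq_trans (H _ sS) _; rewrite rep_count // count_size.
  have tB : (t <= size B)%N.
    apply: leq_trans (H _ sS) _; rewrite rep_count //
      -size_filter -(size_map (fun x => x - s)).
    apply: uniq_leq_size;
      first by rewrite map_inj_uniq ?filter_uniq ?(convex_seq_uniq cA) //; apply: addIr.
    by move=> y /mapP[x]; rewrite mem_filter => /andP[? _] ->.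
  have l5 : (t * l <= 5 * size A)%N by rewrite /l mulnS [(t * (_ %/ _))%N]mulnC;
    have := leq_trunc_div (4 * size A) t; lia.
  have m5 : (t * m <= 5 * size B)%N by rewrite /m mulnS [(t * (_ %/ _))%N]mulnC;
    have := leq_trunc_div (4 * size B) t; lia.
  have t3 : (t <= 3 * t./2)%N by lia.
  have e : (t ^ 3 * size S <= 3 * (t ^ 2 * (size S * t./2)))%N.
    rewrite expnS; nia.
  apply: (leq_trans e).
  have : (t ^ 2 * (size S * t./2) <= (t * l) * size B * (t * m))%N.
    apply: leq_trans (_ : _ <= t ^ 2 * (l * size B * m))%N _; last by apply/eq_leq;
      ring.
    by rewrite leq_mul2l (leq_trans lo up) orbT.
  have : ((t * l) * size B * (t * m) <= (5 * size A) * size B * (5 * size B))%N.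
    exact: leq_mul (leq_mul l5 (leqnn _)) m5.
  by lia.
Qed.

Lemma rep_le_size (F : realDomainType) (A B : seq F) (s : F) :
  uniq B -> (rep A B s <= size A)%N.
Proof. by move=> uB; rewrite rep_count // count_size. Qed.

Lemma sum_rep_cube_le (F : realDomainType) (K : realFieldType) (A B S : seq F) :
  convex_seq A -> uniq B -> uniq S ->
  (\sum_(s <- S) rep A B s ^ 3)%:R <=
  (225 * (size A * size B ^ 2))%:R * \sum_(1 <= t < (size A).+1) t%:R^-1 :> K.
Proof.
move=> cA uB uS; rewrite -[225%N]/(3 * 75)%N -mulnA.
apply: sum_cube_level_le => [t|s]; last exact: rep_le_size.
rewrite -size_filter; apply: size_rich_le => //; first exact: filter_uniq.
by move=> s; rewrite mem_filter => /andP[].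
Qed.

(** * Difference sets and additive energy *)

Definition diff_seq (V : zmodType) (X Y : seq V) : seq V :=
  undup [seq x - y | x <- X, y <- Y].

Lemma diff_seq_uniq (V : zmodType) (X Y : seq V) : uniq (diff_seq X Y).
Proof. exact: undup_uniq. Qed.

Lemma mem_diff_seq (V : zmodType) (X Y : seq V) :
  {in X & Y, forall x y, x - y \in diff_seq X Y}.
Proof. by move=> x y xX yY; rewrite mem_undup; apply: allpairs_f. Qed.

Lemma sum_rep_diff (V : zmodType) (X Y : seq V) (f : V -> nat) :
  (\sum_(t <- diff_seq X Y) rep X Y t * f t =
   \sum_(t <- [seq x - y | x <- X, y <- Y]%R) f t)%N.
Proof.
rewrite big_allpairs_dep; apply: sum_rep; first exact: diff_seq_uniq.
exact: mem_diff_seq.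
Qed.

Lemma sum_rep1 (V : zmodType) (X Y : seq V) :
  (\sum_(t <- diff_seq X Y) rep X Y t = size X * size Y)%N.
Proof.
have := sum_rep_diff X Y (fun=> 1%N); rewrite sum1_size size_allpairs => <-.
by apply: eq_bigr => t _; rewrite muln1.
Qed.

(** Both sides count the solutions of [x - y = x' - y'], rearranged on the right as
    [x - x' = y - y']. *)
Lemma energyE (V : zmodType) (X Y : seq V) :
  (\sum_(t <- diff_seq X Y) rep X Y t ^ 2 =
   \sum_(x <- X) \sum_(x' <- X) rep Y Y (x - x')%R)%N.
Proof.
under eq_bigr do rewrite -mulnn; rewrite sum_rep_diff big_allpairs_dep.
apply: eq_bigr => x _; rewrite exchange_big; apply: eq_bigr => x' _ /=.
apply: eq_bigr => y _; apply: eq_bigr => y' _; congr nat_of_bool.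
by rewrite -subr_eq0 -[RHS]subr_eq0 !opprB addrACA [x' + y]addrC -addrACA.
Qed.

Lemma sqr_size_le (V : zmodType) (X Y : seq V) :
  ((size X * size Y) ^ 2 <=
   size (diff_seq X Y) * \sum_(t <- diff_seq X Y) rep X Y t ^ 2)%N.
Proof.
have := sqr_sum_nat_le (diff_seq X Y) (fun=> 1%N) (rep X Y).
under eq_bigr do rewrite mul1n.
under [X in (_ <= X * _)%N]eq_bigr do rewrite exp1n.
by rewrite sum_rep1 sum1_size.
Qed.

(** Cauchy-Schwarz over the pairs [(x, y)]: there the second moment is the sum of [rep X Y (x - y)]
    and the third moment the sum of its square. *)
Lemma sqr_energy_le (V : zmodType) (X Y : seq V) :
  ((\sum_(t <- diff_seq X Y) rep X Y t ^ 2) ^ 2 <=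
   size X * size Y * \sum_(t <- diff_seq X Y) rep X Y t ^ 3)%N.
Proof.
under eq_bigr do rewrite -mulnn.
under [X in (_ <= _ * X)%N]eq_bigr do rewrite expnS.
rewrite !sum_rep_diff; set P := [seq x - y | x <- X, y <- Y].
have := sqr_sum_nat_le P (fun=> 1%N) (rep X Y).
under eq_bigr do rewrite mul1n.
under [X in (_ <= X * _)%N]eq_bigr do rewrite exp1n.
by rewrite sum1_size size_allpairs.
Qed.

(** * The sets [A_s] and the Katz-Koester inclusion *)

Definition shift_inter (V : zmodType) (A : seq V) (s : V) : seq V :=
  [seq b <- A | b - s \in A].

(** For [b] in [A_s] and [a] in [A], both [b - a] and [(b - a) - s = (b - s) - a] lie in [A - A]. *)
Lemma diff_shift_inter_le (V : zmodType) (A : seq V) (s : V) :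
  (size (diff_seq (shift_inter A s) A) <= rep (diff_seq A A) (diff_seq A A) s)%N.
Proof.
rewrite rep_count ?diff_seq_uniq // -size_filter.
apply: uniq_leq_size; first exact: diff_seq_uniq.
move=> t; rewrite mem_undup mem_filter => /allpairsP[[b a] /= [+ aA ->]].
rewrite mem_filter => /andP[bsA bA].
by rewrite addrAC !mem_diff_seq.
Qed.

(** The map sending [s] to [b - s] is injective, and [(b - s, c - s)] represents [b - c]. *)
Lemma count_shift_le (V : zmodType) (A D : seq V) (b c : V) :
  uniq A -> uniq D ->
  (\sum_(s <- D) ((b - s \in A)%R * (c - s \in A)%R) <= rep A A (b - c)%R)%N.
Proof.
move=> uA uD; rewrite rep_count // -size_filter.
under eq_bigr do rewrite mulnb.
have inj : injective (fun s => b - s) by move=> s t /addrI/oppr_inj.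
rewrite (_ : bigop.body _ _ _ = count (fun s => (b - s \in A) && (c - s \in A)) D);
  last first.
  by rewrite -sum1_count [RHS]big_mkcond; apply: eq_bigr => s _; case: (_ && _).
rewrite -size_filter -(size_map (fun s => b - s)).
apply: uniq_leq_size => [|x /mapP[s]]; first by rewrite map_inj_uniq // filter_uniq.
rewrite mem_filter => /andP[/andP[bA cA] _] ->; rewrite mem_filter bA andbT.
by rewrite opprB addrCA addrAC subrr add0r.
Qed.

(** Summing over [s] first, each pair [(b, c)] of [A] gets at most [rep A A (b - c) ^ 2]; over all
    pairs this adds up to the third moment. *)
Lemma sum_shift_energy_le (V : zmodType) (A : seq V) :
  uniq A ->
  (\sum_(s <- diff_seq A A) \sum_(b <- shift_inter A s)
     \sum_(c <- shift_inter A s) rep A A (b - c)%R <=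
   \sum_(s <- diff_seq A A) rep A A s ^ 3)%N.
Proof.
move=> uA; under [leqRHS]eq_bigr do rewrite expnS.
rewrite sum_rep_diff big_allpairs_dep.
under eq_bigr => s _.
  rewrite big_filter big_mkcond; under eq_bigr => b _.
    rewrite big_filter big_mkcond /=.
    rewrite (_ : (if _ then _ else _) =
      \sum_(c <- A) ((b - s \in A)%R * (c - s \in A)%R) * rep A A (b - c)%R)%N;
      last first.
      case: ifP => _; last by rewrite big1 // => c _; rewrite mul0n.
      by apply: eq_bigr => c _; case: ifP; rewrite ?mul1n.
  over.
over.
rewrite exchange_big; apply: leq_sum => b _ /=.
rewrite exchange_big; apply: leq_sum => c _ /=.
by rewrite -big_distrl -mulnn leq_mul2r count_shift_le ?diff_seq_uniq ?orbT.
Qed.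

(** * The fifth-power bound for the difference set *)

Lemma pow8_size_le (F : rcfType) (A : seq F) :
  convex_seq A ->
  (size A ^ 8)%:R <=
  (225 ^ 3 * size (diff_seq A A) ^ 5)%:R *
    (\sum_(1 <= t < (size A).+1) t%:R^-1) ^+ 3 :> F.
Proof.
move=> cA; have uA := convex_seq_uniq cA.
set n := size A; set D := diff_seq A A; set H := \sum_(_ <= _ < _) _.
have uD : uniq D by exact: diff_seq_uniq.
have H0 : 0 <= H by apply: sumr_ge0 => i _; rewrite invr_ge0.
have [n0|n0] := posnP n; first by rewrite n0 mulr_ge0 // exprn_ge0.
pose E s := (\sum_(b <- shift_inter A s) \sum_(c <- shift_inter A s) rep A A (b -
  c)%R)%N.
pose G s := (rep A A s * rep D D s)%N.
have holder : (n ^ 8)%:R <=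
  (size D * (\sum_(s <- D) E s) * (\sum_(s <- D) G s))%:R :> F.
  (* With [c = n ^ 2] and total mass [n ^ 2] of [rep A A], the left side is [n ^ 2 * (n ^ 2) ^ 3].
     The pointwise hypothesis is Cauchy-Schwarz for [A_s] and [A], multiplied by [rep A A s]. *)
  have := @holder3_le F _ D (n ^ 2)%:R (fun s => (rep A A s)%:R) (fun s => (E
    s)%:R) (fun s => (G s)%:R) (ler0n _ _).
  rewrite -!natr_sum sum_rep1 -natrX -!natrM -[(n ^ 8)%N]/(n ^ (2 + 2 * 3))%N.
  rewrite expnD expnM mulnn -/n; apply => s _.
  rewrite !ler0n -natrX -natrM -natrM ler_nat; split=> //.
  have := sqr_size_le (shift_inter A s) A; rewrite energyE -/(E s).
  rewrite size_filter -rep_count //.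
  have := diff_shift_inter_le A s; rewrite -/D /G => h1 h2.
  have h3 := leq_trans h2 (leq_mul h1 (leqnn _)).
  have := leq_mul (leqnn (rep A A s)) h3.
  by move=> h4; apply: (leq_trans _ (leq_trans h4 _)); apply/eq_leq; rewrite -/n; ring.
have E3 : (\sum_(s <- D) E s)%:R <= (225 * n ^ 3)%:R * H.
  apply: le_trans (_ : _ <= (\sum_(s <- D) rep A A s ^ 3)%:R) _.
    by rewrite ler_nat; apply: sum_shift_energy_le.
  by rewrite expnS; apply: sum_rep_cube_le.
(* The sum of [G] is the additive energy of [A] and [D]. *)
have G2 : ((\sum_(s <- D) G s) ^ 2)%:R <= (225 * n ^ 2 * size D ^ 3)%:R * H.
  rewrite sum_rep_diff big_allpairs_dep -energyE.
  apply: le_trans (_ : _ <= (n * size D)%:R * (225 * (n * size D ^ 2))%:R * H) _;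
    last first.
    by rewrite -natrM (_ : (n * _ * _ = 225 * n ^ 2 * size D ^ 3)%N) //; ring.
  apply: le_trans (_ : _ <= (n * size D * \sum_(t <- diff_seq A D) rep A D t ^ 3)%:R) _.
    by rewrite ler_nat sqr_energy_le.
  rewrite [leLHS]natrM -mulrA; apply: ler_wpM2l => //.
  by apply: sum_rep_cube_le => //; apply: diff_seq_uniq.
(* [G2] controls only the square, so [holder] is squared: the bounds then carry
   [(n ^ 3) ^ 2 * n ^ 2 = n ^ 8], which cancels against [n ^ 16]. *)
have nF : 0 < (n ^ 8)%:R :> F by rewrite ltr0n expn_gt0 n0.
rewrite -(ler_pM2r nF).
apply: le_trans (_ : _ <=
  ((size D * (\sum_(s <- D) E s) * (\sum_(s <- D) G s))%:R ^+ 2)) _.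
  by rewrite -expr2 ler_pXn2r ?nnegrE.
rewrite -natrX !expnMn natrM [X in X * _]natrM [in leRHS]natrM.
apply: le_trans (_ : _ <=
  (size D ^ 2)%:R * ((225 * n ^ 3)%:R * H) ^+ 2 * ((225 * n ^ 2 * size D ^ 3)%:R *
  H)) _.
  apply: ler_pM => //; rewrite ?mulr_ge0 //.
  by rewrite ler_wpM2l // natrX ler_pXn2r ?nnegrE ?mulr_ge0.
rewrite [leLHS](_ : _ = (225 ^ 3 * size D ^ 5)%:R * H ^+ 3 * (n ^ 8)%:R);
  rewrite !(natrX, natrM); first exact: lexx.
by ring.
Qed.

(** * Transfer to Stdlib lists and logarithms *)

Lemma list_nthE (T : Type) (x : T) (s : list T) (i : nat) :
  List.nth i s x = nth x s i.
Proof. by elim: s i => [|y s IH] [|i] //=. Qed.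

Lemma list_InP (T : eqType) (x : T) (s : list T) : In x s <-> x \in s.
Proof.
elim: s => [|y s IH] //=; rewrite inE; split=> [[->|/IH ->]|/orP[/eqP->|/IH]].
- by rewrite eqxx.
- by rewrite orbT.
- by left.
- by right.
Qed.

Lemma uniq_NoDup (T : eqType) (s : list T) : uniq s -> NoDup s.
Proof.
elim: s => [|x s IH] /=; first by constructor.
by case/andP=> xs /IH; constructor => // /list_InP; apply/negP.
Qed.

Lemma convex_list_seq (A : list R) :
  strictly_increasing A -> convex_list A -> convex_seq A.
Proof.
move=> inc cvx; split=> i /ssrnat.ltP h; apply/RltP.
- by have := inc i h; rewrite !list_nthE.
- by have := cvx i h; rewrite !list_nthE.
Qed.

Lemma size_diff_seq_le (A : list R) : (size (diff_seq A A) <= diffset_card A)%N.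
Proof.
apply/ssrnat.leP/NoDup_incl_length; first exact/uniq_NoDup/diff_seq_uniq.
move=> x /list_InP; rewrite mem_undup => /allpairsP[[a b] /=
  [/list_InP aA /list_InP bA ->]].
apply/nodup_In/in_flat_map; exists a; split => //.
by apply/in_map_iff; exists b.
Qed.

Lemma harmonic_le_ln (n : nat) :
  \sum_(1 <= t < n.+2) t%:R^-1 <= 1 + ln (INR n.+1) :> R.
Proof.
elim: n => [|n IH]; first by rewrite big_nat1 invr1 ln_1 addr0.
rewrite big_nat_recr //; have /RleP := inv_le_ln_succ_sub n.
by rewrite RinvE RminusE !INRE in IH * => /(lerD IH); rewrite -addrA subrKC.
Qed.

Lemma diffset_card_pow5_ge (A : list R) :
  strictly_increasing A -> convex_list A -> (0 < size A)%N ->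
  Rle (INR (length A) ^ 8)
    (Rmult (Rmult (225 ^ 3) (INR (diffset_card A) ^ 5))
       ((Rplus 1 (ln (INR (length A)))) ^ 3)).
Proof.
move=> inc cvx A0; apply/RleP; rewrite !RpowE !RmultE RplusE !INRE IZRposE INRE.
rewrite -[X in X <= _]natrX.
apply: le_trans (pow8_size_le (convex_list_seq inc cvx)) _.
apply: ler_pM => //.
- by rewrite exprn_ge0 // sumr_ge0 // => i _; rewrite invr_ge0.
- rewrite natrM !natrX ler_pM2l ?exprn_gt0 ?ltr0n //.
  by rewrite ler_pXn2r ?nnegrE // ler_nat size_diff_seq_le.
- have := harmonic_le_ln (size A).-1; rewrite prednK // => h.
  have H0 : 0 <= \sum_(1 <= t < (size A).+1) t%:R^-1 :> R.
    by apply: sumr_ge0 => i _; rewrite invr_ge0.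
  rewrite -INRE ler_pXn2r ?nnegrE //.
  exact: le_trans H0 h.
Qed.
End ConvexDifference.

Theorem theorem5 :
  exists c C : R, 0 < c /\ 0 <= C /\
    forall A : list R,
      strictly_increasing A -> convex_list A -> (2 <= length A)%nat ->
      INR (diffset_card A) >=
        c * Rpower (INR (length A)) (8 / 5) / Rpower (ln (INR (length A))) C.
Proof.
  (* The factor [3 ^ 3] absorbs [1 + ln n <= 3 * ln n], which follows from [ln n > 1 / 2]. *)
  set (K := 225 ^ 3 * 3 ^ 3).
  assert (0 < K) as K0 by (unfold K; lra).
  exists (Rpower K (- / 5)), (3 / 5).
  split; [apply exp_pos | split; [lra |]].
  intros A inc cvx A2.
  assert (0 < length A)%nat as A0 by (apply Nat.lt_le_trans with 2%nat; auto).
  pose proof (ConvexDifference.diffset_card_pow5_ge inc cvx) as main.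
  specialize (main ltac:(destruct A; [inversion A0 | reflexivity])).
  apply le_INR in A2; change (INR 2) with (1 + 1) in A2.
  set (n := INR (length A)) in *; set (m := INR (diffset_card A)) in *.
  assert (/ 2 < ln n) as L2.
  { apply Rlt_le_trans with (1 := ln_lt_2).
    destruct (Rle_lt_or_eq_dec 2 n ltac:(lra)) as [lt | <-]; [| lra].
    apply Rlt_le, ln_increasing; lra. }
  set (L := ln n) in *.
  set (B := Rpower K (- / 5) * Rpower n (8 / 5) / Rpower L (3 / 5)).
  assert (0 < B) as B0.
  { apply Rdiv_lt_0_compat; [apply Rmult_lt_0_compat |]; apply exp_pos. }
  assert (0 <= m) as m0 by apply pos_INR.
  (* [B] is the exact fifth root of [n ^ 8 / (K * L ^ 3)], so [m < B] would contradict the bound on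
     [m ^ 5]. *)
  assert (K * L ^ 3 * B ^ 5 = n ^ 8) as B5.
  { unfold B, Rdiv at 1. rewrite !Rpow_mult_distr, pow_inv, !Rpower_pow_l.
    change (INR 5) with (1 + 1 + 1 + 1 + 1).
    replace (- / 5 * (1 + 1 + 1 + 1 + 1)) with (- (1)) by field.
    replace (8 / 5 * (1 + 1 + 1 + 1 + 1)) with (INR 8) by (simpl; field).
    replace (3 / 5 * (1 + 1 + 1 + 1 + 1)) with (INR 3) by (simpl; field).
    rewrite Rpower_Ropp, Rpower_1, !Rpower_pow by lra.
    field; lra. }
  assert (n ^ 8 <= K * L ^ 3 * m ^ 5) as main'.
  { apply Rle_trans with (1 := main). unfold K.
    replace (225 ^ 3 * 3 ^ 3 * L ^ 3 * m ^ 5)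
      with (225 ^ 3 * m ^ 5 * (3 * L) ^ 3) by ring.
    apply Rmult_le_compat_l.
    - apply Rmult_le_pos; [lra | now apply pow_le].
    - apply pow_incr; lra. }
  apply Rle_ge, Rnot_lt_le; intros lt.
  assert (0 < K * L ^ 3) as KL by (apply Rmult_lt_0_compat; [| apply pow_lt]; lra).
  assert (m ^ 5 < B ^ 5) as lt5.
  { assert (m ^ 4 <= B ^ 4) as le4 by (apply pow_incr; lra).
    assert (0 < B ^ 4) as B4 by (apply pow_lt; lra).
    change (m * m ^ 4 < B * B ^ 4); nra. }
  pose proof (Rmult_lt_compat_l _ _ _ KL lt5); lra.
Qed.
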